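(* Let $f:\mathbb{R}^n\to(-\infty,+\infty]$ be proper, lower semicontinuous and prox-bounded with threshold $\lambda_f>0$, let $0<\mu<\lambda_f$ and let $\kappa>0$. Then the following are equivalent: (a) the proximal mapping $\operatorname{Prox}_{\mu}f$ is Lipschitz continuous with constant $\kappa$; (b) the function $f+\frac{\kappa-1}{2\mu\kappa}\|\cdot\|^2$ is convex.
   Context: $\|\cdot\|$ is the Euclidean norm on $\mathbb{R}^n$. For a proper function $f$ and $\mu>0$, $e_{\mu}f(x)=\inf_{w}\{f(w)+\frac{1}{2\mu}\|w-x\|^2\}$ is the Moreau envelope and $\operatorname{Prox}_{\mu}f(x)=\operatorname{argmin}_{w}\{f(w)+\frac{1}{2\mu}\|w-x\|^2\}$ is the (set-valued) proximal mapping. $f$ is prox-bounded if there exist $\lambda>0$ and $x$ with $e_{\lambda}f(x)>-\infty$; the supremum $\lambda_f\in(0,+\infty]$ of all such $\lambda$ is its threshold. ''$\operatorname{Prox}_\mu f$ is Lipschitz continuous with constant $\kappa$'' means that $\operatorname{Prox}_\mu f(x)$ is a singleton for every $x\in\mathbb{R}^n$ and the resulting map $\mathbb{R}^n\to\mathbb{R}^n$ is $\kappa$-Lipschitz. *)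

(* Defs.v *)
From HB Require Import structures.
From mathcomp Require Import all_boot all_order all_algebra.
From mathcomp Require Import all_classical all_reals all_analysis.

Set Implicit Arguments.
Unset Strict Implicit.
Unset Printing Implicit Defensive.

Import Order.TTheory GRing.Theory Num.Theory.
Import numFieldNormedType.Exports.

Local Open Scope classical_set_scope.
Local Open Scope ring_scope.

(* The library's norm `|x| on 'rV[R]_n is the max norm, so neither it nor the
   library's Lipschitz predicate can be used here. The topology used by
   lower_semicontinuous is the usual one on R^n for both norms. *)
Definition enorm (R : realType) (n : nat) (x : 'rV[R]_n) : R :=
  Num.sqrt (\sum_(i < n) x 0 i ^+ 2).

Definition proper_function (R : realType) (n : nat) (f : 'rV[R]_n -> \bar R) : Prop :=
  (forall x, (-oo < f x)%E) /\ (exists x, (f x < +oo)%E).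

Definition prox_obj (R : realType) (n : nat) (mu : R)
    (f : 'rV[R]_n -> \bar R) (x w : 'rV[R]_n) : \bar R :=
  (f w + ((2 * mu)^-1 * enorm (w - x) ^+ 2)%:E)%E.

Definition moreau_env (R : realType) (n : nat) (mu : R)
    (f : 'rV[R]_n -> \bar R) (x : 'rV[R]_n) : \bar R :=
  ereal_inf [set prox_obj mu f x w | w in setT].

Definition argmin (R : realType) (T : Type) (g : T -> \bar R) : set T :=
  [set w | forall z, (g w <= g z)%E].

Definition prox (R : realType) (n : nat) (mu : R)
    (f : 'rV[R]_n -> \bar R) (x : 'rV[R]_n) : set 'rV[R]_n :=
  argmin (prox_obj mu f x).

Definition prox_parameters (R : realType) (n : nat)
    (f : 'rV[R]_n -> \bar R) : set R :=
  [set lam | 0 < lam /\ exists x, (-oo < moreau_env lam f x)%E].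

Definition prox_bounded (R : realType) (n : nat)
    (f : 'rV[R]_n -> \bar R) : Prop :=
  prox_parameters f !=set0.

Definition prox_threshold (R : realType) (n : nat)
    (f : 'rV[R]_n -> \bar R) : \bar R :=
  ereal_sup [set lam%:E | lam in prox_parameters f].

Definition set_valued_lipschitz (R : realType) (n : nat) (kappa : R)
    (F : 'rV[R]_n -> set 'rV[R]_n) : Prop :=
  exists P : 'rV[R]_n -> 'rV[R]_n,
    (forall x, F x = [set P x]) /\
    (forall x y, enorm (P x - P y) <= kappa * enorm (x - y)).

(* Meant for functions that never take the value -oo: the library's
   convention is -oo + +oo = -oo. *)
Definition econvex (R : realType) (n : nat) (g : 'rV[R]_n -> \bar R) : Prop :=
  forall (x y : 'rV[R]_n) (t : R), 0 < t -> t < 1 ->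
    (g ((1 - t) *: x + t *: y)%R <= (1 - t)%:E * g x + t%:E * g y)%E.

(* Main.v *)
Require Import Defs.
From HB Require Import structures.
From mathcomp Require Import all_boot all_order all_algebra.
From mathcomp Require Import all_classical all_reals all_analysis.
From mathcomp Require Import ring lra.
Import Order.TTheory GRing.Theory Num.Theory.
Import numFieldNormedType.Exports.

Local Open Scope classical_set_scope.
Local Open Scope ring_scope.

(* (b) => (a): the proximal objective at x is strongly convex with modulus
   1 / (mu kappa) and bounded below, so minimizing sequences are Cauchy and it has
   a unique minimizer P x; adding the quadratic growth inequalities of the
   objectives at x and y around P x and P y gives
   |P x - P y|^2 <= kappa <x - y, P x - P y>.

   (a) => (b): put G = mu f + |.|^2 / 2. The conjugate H of G is finite with
   gradient P, which is kappa-Lipschitz, so the biconjugate of G is strongly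
   convex with modulus 1 / kappa, and it remains to bound G by its biconjugate.
   For every w and small dl > 0, an approximate solution y of P y + dl y = w nearly
   minimizes H - <., w> + dl |.|^2 / 2. Then G (P y) exceeds the biconjugate at w
   by little, while P y is close to w, and lower semicontinuity concludes. *)

(** * Euclidean inner product and norm *)

Definition dot {R : realType} {n : nat} (u v : 'rV[R]_n) : R :=
  \sum_(i < n) u 0 i * v 0 i.

Section Dot.
Context {R : realType} {n : nat}.
Implicit Types (u v w x y : 'rV[R]_n) (c t : R).

Lemma dotC u v : dot u v = dot v u.
Proof. by apply: eq_bigr => i _; rewrite mulrC. Qed.

Lemma dotDl u v w : dot (u + v) w = dot u w + dot v w.
Proof. by rewrite -big_split; apply: eq_bigr => i _; rewrite mxE mulrDl. Qed.

Lemma dotZl c u v : dot (c *: u) v = c * dot u v.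
Proof. by rewrite mulr_sumr; apply: eq_bigr => i _; rewrite mxE mulrA. Qed.

Lemma dotNl u v : dot (- u) v = - dot u v.
Proof. by rewrite -scaleN1r dotZl mulN1r. Qed.

Lemma dotDr u v w : dot u (v + w) = dot u v + dot u w.
Proof. by rewrite dotC dotDl !(dotC u). Qed.

Lemma dotZr c u v : dot u (c *: v) = c * dot u v.
Proof. by rewrite dotC dotZl dotC. Qed.

Lemma dotNr u v : dot u (- v) = - dot u v.
Proof. by rewrite dotC dotNl dotC. Qed.

Lemma dot0l u : dot 0 u = 0.
Proof. by rewrite -(scale0r u) dotZl mul0r. Qed.

Definition dotE := (dotDl, dotDr, dotZl, dotZr, dotNl, dotNr).

Lemma dot_ge0 u : 0 <= dot u u.
Proof. by apply: sumr_ge0 => i _; rewrite -expr2 sqr_ge0. Qed.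

Lemma dot_coord_le u (i : 'I_n) : u 0 i ^+ 2 <= dot u u.
Proof.
rewrite /dot (bigD1 i)//= -expr2 lerDl.
by apply: sumr_ge0 => j _; rewrite -expr2 sqr_ge0.
Qed.

Lemma dot_le_coord u (e : R) :
  (forall i, `|u 0 i| <= e) -> dot u u <= n%:R * e ^+ 2.
Proof.
move=> ue; rewrite mulr_natl -[n in leRHS]card_ord -sumr_const.
apply: ler_sum => i _; rewrite -expr2 -real_normK ?num_real//.
by rewrite lerXn2r ?nnegrE// (le_trans _ (ue i)).
Qed.

Lemma dot_eq0 u : dot u u <= 0 -> u = 0.
Proof.
move=> u0; apply/rowP => i; rewrite mxE; apply/eqP.
by rewrite -sqrf_eq0 eq_le sqr_ge0 (le_trans (dot_coord_le u i)).
Qed.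

Lemma enorm_sqr u : enorm u ^+ 2 = dot u u.
Proof.
by rewrite sqr_sqrtr; [apply: eq_bigr => i _; rewrite expr2
                      |apply: sumr_ge0 => i _; rewrite sqr_ge0].
Qed.

Lemma enorm_ge0 u : 0 <= enorm u.
Proof. exact: sqrtr_ge0. Qed.

Lemma enorm_le_sqr u c : 0 <= c -> (enorm u <= c) = (dot u u <= c ^+ 2).
Proof. by move=> c0; rewrite -enorm_sqr ler_pXn2r ?nnegrE// enorm_ge0. Qed.

Lemma coord_le_enorm u (i : 'I_n) : `|u 0 i| <= enorm u.
Proof.
rewrite -(@ler_pXn2r _ 2)// ?nnegrE ?enorm_ge0//.
by rewrite real_normK ?num_real// enorm_sqr dot_coord_le.
Qed.

(** Cauchy-Schwarz: the square of [dot v v *: u - dot u v *: v] is [dot v v] times the gap between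
    the two sides. *)
Lemma dot_le_sqr u v : dot u v ^+ 2 <= dot u u * dot v v.
Proof.
have [v0|v0] := eqVneq (dot v v) 0.
  suff -> : v = 0 by rewrite dotC !dot0l expr0n mulr0.
  by apply: dot_eq0; rewrite v0.
have vp : 0 < dot v v by rewrite lt_def v0 dot_ge0.
have := dot_ge0 (dot v v *: u - dot u v *: v).
rewrite !dotE (dotC v u).
set a := dot u u; set b := dot u v; set d := dot v v => H.
have : 0 <= d * (a * d - b ^+ 2) by nra.
by rewrite pmulr_rge0// subr_ge0.
Qed.

Lemma dot_le_enorm u v : dot u v <= enorm u * enorm v.
Proof.
rewrite (le_trans (ler_norm _))// -(@ler_pXn2r _ 2)// ?nnegrE ?mulr_ge0 ?enorm_ge0//.
by rewrite exprMn !enorm_sqr real_normK ?num_real// dot_le_sqr.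
Qed.

Lemma dot_convex_comb (a b : 'rV[R]_n) t :
  dot ((1 - t) *: a + t *: b) ((1 - t) *: a + t *: b) =
  (1 - t) * dot a a + t * dot b b - t * (1 - t) * dot (a - b) (a - b).
Proof. by rewrite !dotE (dotC b a); ring. Qed.

End Dot.

Lemma small_geometric {R : realType} (rho X e : R) : 0 <= rho < 1 -> 0 < e ->
  exists k : nat, X * rho ^+ k < e.
Proof.
move=> /andP[r0 r1] e0.
have /cvg_geometric/cvgrPdist_lt/(_ e e0) : `|rho| < 1 by rewrite ger0_norm.
move=> /(_ X) [k _ /(_ k (leqnn k))]/=.
rewrite sub0r normrN => h; exists k; exact: le_lt_trans (ler_norm _) h.
Qed.

(** * Conjugate functions with Lipschitz gradient *)

Section ConjugateGradient.
Context {R : realType} {n : nat}.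
Variables (S : set 'rV[R]_n) (G : 'rV[R]_n -> R) (P : 'rV[R]_n -> 'rV[R]_n).
Variable kappa : R.
Hypothesis kappa_gt0 : 0 < kappa.
Hypothesis P_mem : forall x, S (P x).
Hypothesis P_max : forall x z, S z -> dot x z - G z <= dot x (P x) - G (P x).
Hypothesis P_lip : forall x y, enorm (P x - P y) <= kappa * enorm (x - y).

(** By [P_max], the conjugate of [G] restricted to [S], attained at [P x]. *)
Let H x := dot x (P x) - G (P x).

Lemma P_lip_sqr x y :
  dot (P x - P y) (P x - P y) <= kappa ^+ 2 * dot (x - y) (x - y).
Proof.
rewrite -!enorm_sqr -exprMn ler_pXn2r ?nnegrE ?enorm_ge0//.
by rewrite mulr_ge0 ?enorm_ge0// ltW.
Qed.

(** [P u] competes in the supremum [H v], so it is a subgradient of [H] at [u]. *)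
Lemma conjugate_diff_le u v : H u - H v <= dot (u - v) (P u).
Proof. by have := P_max v (P u) (P_mem u); rewrite /H !dotE; lra. Qed.

Lemma P_monotone u v : 0 <= dot (u - v) (P u - P v).
Proof.
have := conjugate_diff_le u v; have := conjugate_diff_le v u.
by rewrite !dotE; lra.
Qed.

(* Bisecting the segment [y, y + d] maps an admissible constant C in
   H (y + d) <= H y + <d, P y> + C |d|^2 to kappa / 4 + C / 2, whose fixed
   point is kappa / 2. *)
Lemma conjugate_descent y d :
  H (y + d) <= H y + dot d (P y) + kappa / 2 * dot d d.
Proof.
have addrBl (u v : 'rV[R]_n) : u + v - u = v by rewrite addrC addKr.
have step k : forall y d, H (y + d) <=
    H y + dot d (P y) + (kappa / 2 + kappa / 2 * 2^-1 ^+ k) * dot d d.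
  elim: k => [|k IH] {}y {}d.
    have := conjugate_diff_le (y + d) y; rewrite addrBl expr0.
    have := dot_le_enorm d (P (y + d) - P y).
    have := P_lip (y + d) y; rewrite addrBl -enorm_sqr !dotE.
    have := enorm_ge0 d; nra.
  have h1 := IH y (2^-1 *: d); have h2 := IH (y + 2^-1 *: d) (2^-1 *: d).
  have dd : 2^-1 *: d + 2^-1 *: d = d by rewrite -scalerDl -[RHS]scale1r; congr (_ *: _); lra.
  rewrite -addrA dd in h2.
  have := dot_le_enorm d (P (y + 2^-1 *: d) - P y).
  have := P_lip (y + 2^-1 *: d) y; rewrite addrBl.
  have -> : enorm (2^-1 *: d) = 2^-1 * enorm d.
    apply/eqP; rewrite -(@eqrXn2 _ 2)// ?mulr_ge0 ?enorm_ge0 ?invr_ge0//.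
    by rewrite exprMn !enorm_sqr !dotE; apply/eqP; ring.
  move: h1 h2; rewrite exprS !dotE -!enorm_sqr => h1 h2 h3 h4.
  have := enorm_ge0 d => e0.
  have : enorm d * enorm (P (y + 2^-1 *: d) - P y) <= enorm d * (kappa * (2^-1 * enorm d)).
    by rewrite ler_wpM2l.
  by lra.
apply/ler_addgt0Pr => e e0.
have [//|k] := small_geometric 2^-1 (kappa / 2 * dot d d) e _ e0.
  by apply/andP; split; lra.
by have := step k y d; lra.
Qed.

(** Smoothness of [H] dualizes to strong convexity: the Fenchel inequality is used at two shifts of
    [y] along [a - b]. Their average with weights [1 - t] and [t] is zero, so the terms in [P y]
    cancel; their size maximizes the gain. *)
Lemma biconjugate_strongly_convex (a b : 'rV[R]_n) t y : S a -> S b ->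
  0 < t -> t < 1 ->
  dot y ((1 - t) *: a + t *: b) - H y <=
  (1 - t) * G a + t * G b - (2 * kappa)^-1 * (t * (1 - t) * dot (a - b) (a - b)).
Proof.
move=> Sa Sb t0 t1.
have ha := P_max (y + (t / kappa) *: (a - b)) a Sa.
have hb := P_max (y + - ((1 - t) / kappa) *: (a - b)) b Sb.
have da := conjugate_descent y ((t / kappa) *: (a - b)).
have db := conjugate_descent y (- ((1 - t) / kappa) *: (a - b)).
have {}ha := le_trans ha da; have {}hb := le_trans hb db.
have {ha} : 0 <= (1 - t) * (H y + dot ((t / kappa) *: (a - b)) (P y) +
   kappa / 2 * dot ((t / kappa) *: (a - b)) ((t / kappa) *: (a - b)) -
   (dot (y + (t / kappa) *: (a - b)) a - G a)).
  by rewrite mulr_ge0// subr_ge0// ltW.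
have {hb} : 0 <= t * (H y + dot (- ((1 - t) / kappa) *: (a - b)) (P y) +
   kappa / 2 * dot (- ((1 - t) / kappa) *: (a - b)) (- ((1 - t) / kappa) *: (a - b)) -
   (dot (y + - ((1 - t) / kappa) *: (a - b)) b - G b)).
  by rewrite mulr_ge0// ?subr_ge0// ltW.
move=> hb ha; rewrite -subr_ge0; apply: le_trans (addr_ge0 ha hb) _.
rewrite le_eqVlt; apply/orP; left; apply/eqP.
rewrite !dotE (dotC b a); field.
exact: lt0r_neq0.
Qed.

(* The exact equation P y + e y = w would need Banach's fixed point theorem for
   the Euclidean norm; iterating y |-> y - s r(y), which contracts the residual
   r(y) = P y + e y - w, already gives an approximate solution. *)
Lemma approx_resolvent (w : 'rV[R]_n) (e d : R) : 0 < e -> 0 < d ->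
  exists y, dot (P y + e *: y - w) (P y + e *: y - w) <= d.
Proof.
move=> e0 d0.
pose r y := P y + e *: y - w.
(* The map [P y + e y] is [e]-strongly monotone and [(kappa + e)]-Lipschitz, so a step [s] scales
   the squared residual by at most [1 - 2 e s + s^2 (kappa + e)^2]; this [s] minimizes that factor,
   with value [rho]. *)
pose s := e / (kappa + e) ^+ 2.
have ke : 0 < kappa + e by rewrite addr_gt0.
pose rho := 1 - e ^+ 2 / (kappa + e) ^+ 2.
have rho01 : 0 <= rho < 1.
  rewrite /rho subr_ge0 ltrBlDr ltrDl divr_gt0 ?exprn_gt0// andbT.
  rewrite ler_pdivrMr ?exprn_gt0// mul1r ler_pXn2r ?nnegrE ?(ltW e0) ?(ltW ke)//.
  by rewrite lerDr ltW.
have contr y : dot (r (y - s *: r y)) (r (y - s *: r y)) <= rho * dot (r y) (r y).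
  set z := y - s *: r y.
  have yz : y - z = s *: r y by rewrite /z opprB addrC subrK.
  have [p pE] : exists p, p = P y - P z by eexists.
  have [q qE'] : exists q, q = y - z by eexists.
  have -> : r z = r y - (p + e *: q).
    by rewrite pE qE'; apply/rowP => i; rewrite /r !mxE; ring.
  have pm : 0 <= dot q p by rewrite pE qE'; exact: P_monotone.
  have pl : dot p p <= kappa ^+ 2 * dot q q by rewrite pE qE'; exact: P_lip_sqr.
  have qE : q = s *: r y by rewrite qE'.
  have pq : dot q p <= kappa * dot q q.
    have := dot_le_enorm q p; have := P_lip y z.
    rewrite -pE -qE' -enorm_sqr; have := enorm_ge0 q; nra.
  move: (r y) qE => v qE.
  have rq : dot v (p + e *: q) * s = dot q p + e * dot q q.
    by rewrite dotDr dotZr {2 3}qE !dotZl; ring.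
  have s0 : 0 < s by rewrite divr_gt0// exprn_gt0.
  have qq : dot q q = s ^+ 2 * dot v v by rewrite qE !dotE; ring.
  have B : dot (p + e *: q) (p + e *: q) <= (kappa + e) ^+ 2 * dot q q.
    by rewrite !dotE (dotC p q); nra.
  have -> : dot (v - (p + e *: q)) (v - (p + e *: q)) =
     dot v v - 2 * dot v (p + e *: q) + dot (p + e *: q) (p + e *: q).
    by rewrite !dotE (dotC p v) (dotC q v) (dotC q p); ring.
  have A : e * s * dot v v <= dot v (p + e *: q).
    rewrite -(ler_pM2r s0) rq; apply: (@le_trans _ _ (e * dot q q)); last by lra.
    by rewrite qq; lra.
  have E1 : (kappa + e) ^+ 2 * dot q q = e * s * dot v v.
    by rewrite qq /s; field; exact: lt0r_neq0.
  have -> : rho = 1 - e * s by rewrite /rho /s; field; exact: lt0r_neq0.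
  by lra.
have [k hk] := small_geometric rho (dot (r 0) (r 0)) d rho01 d0.
have [y hy] : exists y, dot (r y) (r y) <= dot (r 0) (r 0) * rho ^+ k.
  elim: k {hk} => [|k [y hy]]; first by exists 0; rewrite expr0 mulr1.
  exists (y - s *: r y); apply: le_trans (contr y) _.
  by rewrite exprS mulrCA ler_wpM2l//; case/andP: rho01.
by exists y; apply: (le_trans hy (ltW hk)).
Qed.

(** The hypothesis says that [M] bounds the biconjugate at [w]; lower semicontinuity of [G] can then
    carry the bound over to [G w]. *)
Lemma approx_by_range (w : 'rV[R]_n) (M e : R) :
  (forall y, dot y w - H y <= M) -> 0 < e ->
  exists y, enorm (P y - w) <= e /\ G (P y) <= M + e.
Proof.
move=> hM e0.
pose K := M + H 0 + 1.
have K1 : 1 <= K by have := hM 0; rewrite /K dot0l; lra.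
(* dl is chosen so that |P y - w|^2 <= 2 (|dl y|^2 + |r|^2) <= e^2, where r is
   the residual and dl |y|^2 <= 2 K. *)
pose dl := Num.min (Num.min e 1) (e ^+ 2 / (6 * K)).
have dl0 : 0 < dl.
  by rewrite !lt_min e0 ltr01/= divr_gt0 ?exprn_gt0// mulr_gt0//; lra.
have dle : dl <= e by rewrite /dl !ge_min lexx.
have dl1 : dl <= 1 by rewrite /dl !ge_min lexx orbT.
have dlK : dl * (6 * K) <= e ^+ 2.
  by rewrite -ler_pdivlMr ?mulr_gt0//; [rewrite /dl ge_min lexx orbT|lra].
have [//|y hy] := approx_resolvent w dl (dl ^+ 2) dl0; first by rewrite exprn_gt0.
exists y; have [r rE] : exists r, r = P y + dl *: y - w by eexists.
rewrite -rE in hy.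
have wE : w = P y + dl *: y - r by rewrite rE opprB addrC subrK.
have yr : dot y r <= dl / 2 * dot y y + dl / 2.
  have := dot_ge0 (dl *: y - r); rewrite !dotE (dotC r y) => h.
  have : 0 <= dl * (dl * dot y y + dl - 2 * dot y r) by nra.
  by rewrite pmulr_rge0//; lra.
(* Substituting [w = P y + dl y - r] in [hM y] cancels [dot y (P y)]; half of [dl |y|^2] absorbs the
   residual term. *)
have key : G (P y) + dl / 2 * dot y y <= M + dl / 2.
  by have := hM y; rewrite {1}wE /H (dotDr _ _ (- r)) dotDr dotZr dotNr; lra.
have Glb : - H 0 <= G (P y).
  have := P_max 0 (P y) (P_mem y); rewrite -/(H 0).
  by rewrite dot0l; lra.
split; last by have := mulr_ge0 (ltW dl0) (dot_ge0 y); lra.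
rewrite enorm_le_sqr; last exact: ltW.
have -> : P y - w = r - dl *: y by rewrite rE; apply/rowP => i; rewrite !mxE; ring.
have yy : dl * dot y y <= 2 * K by rewrite /K; lra.
have := dot_ge0 (r + dl *: y); rewrite !dotE (dotC r y).
have : dl * (dl * dot y y) <= dl * (2 * K) by rewrite ler_wpM2l// ltW.
have : dl ^+ 2 <= dl * K by nra.
by lra.
Qed.

End ConjugateGradient.

(** * Convexity, proximal points and lower semicontinuity for extended real values *)

Section ProperFunction.
Context {R : realType} {n : nat}.
Variable f : 'rV[R]_n -> \bar R.
Hypothesis f_gtNy : forall x, (-oo < f x)%E.
Implicit Types (a b p v w x y z : 'rV[R]_n).

(** The quadratic becomes an explicit defect by [dot_convex_comb]; an endpoint of value [+oo] makes
    the inequality trivial. *)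
Lemma econvex_quadraticP (c : R) :
  econvex (fun x => (f x + (c * enorm x ^+ 2)%:E)%E) <->
  forall a b (al be t : R), f a = al%:E -> f b = be%:E -> 0 < t -> t < 1 ->
    (f ((1 - t) *: a + t *: b) <=
      ((1 - t) * al + t * be + c * (t * (1 - t) * dot (a - b) (a - b)))%:E)%E.
Proof.
split=> [h a b al be t fa fb t0 t1|h a b t t0 t1].
  move: (h a b t t0 t1); rewrite fa fb !enorm_sqr dot_convex_comb.
  case: (f _) (f_gtNy ((1 - t) *: a + t *: b)) => [r||]//= _.
  by rewrite !lee_fin; lra.
have t1' : 0 < 1 - t by rewrite subr_gt0.
case fa : (f a) (f_gtNy a) => [al||]// _; case fb : (f b) (f_gtNy b) => [be||]// _.
- have := h a b al be t fa fb t0 t1.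
  case: (f _) (f_gtNy ((1 - t) *: a + t *: b)) => [r||]//= _.
  by rewrite !enorm_sqr dot_convex_comb !lee_fin; lra.
- by rewrite addye// gt0_muley ?lte_fin// addey// leey.
- by rewrite addye// gt0_muley ?lte_fin// addye// leey.
- by rewrite !addye// !gt0_muley ?lte_fin// leey.
Qed.

Lemma prox_finP (f_fin : exists x, (f x < +oo)%E) (mu : R) x p :
  prox mu f x p <-> exists2 phi, f p = phi%:E &
    forall z ze, f z = ze%:E ->
      phi + (2 * mu)^-1 * dot (p - x) (p - x) <=
      ze + (2 * mu)^-1 * dot (z - x) (z - x).
Proof.
rewrite /prox /argmin /prox_obj; split=> [/= h|[phi fp h] z /=].
  have [phi fp] : exists phi, f p = phi%:E.
    have [z] := f_fin; move: (h z).
    case: (f z) (f_gtNy z) => [ze||]// _ + _.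
    by case: (f p) (f_gtNy p) => [r||]//; exists r.
  exists phi => // z ze fz.
  by move: (h z); rewrite fp fz !enorm_sqr lee_fin.
case fz : (f z) (f_gtNy z) => [ze||]// _; last by rewrite addye// leey.
by rewrite fp !enorm_sqr lee_fin; exact: h.
Qed.

(** Serves both implications: the approximants are a minimizing sequence in one and points [P y] in
    the other. *)
Lemma lsc_quadratic_le (f_lsc : lower_semicontinuous f) (c M : R) x w :
  0 <= c ->
  (forall e : R, 0 < e -> exists v phi, [/\ f v = phi%:E, enorm (v - w) <= e &
     phi + c * dot (v - x) (v - x) <= M + e]) ->
  (f w <= (M - c * dot (w - x) (w - x))%:E)%E.
Proof.
move=> c0 approx; set a := M - _; rewrite leNgt; apply/negP => afw.
have [a' aa' a'fw] : exists2 a' : R, a < a' & (a'%:E < f w)%E.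
  move: afw; case: (f w) => [r||]//; rewrite ?lte_fin => ar.
    by exists ((a + r) / 2); rewrite ?lte_fin; lra.
  by exists (a + 1); rewrite ?ltry//; lra.
have [V /nbhs_ballP[dl /= dl0 wV] fV] := f_lsc w a' a'fw.
(* [e K] bounds the slack [e] plus the possible drop of the quadratic between [w] and [v]. *)
set K := 1 + 2 * c * enorm (w - x).
have K1 : 1 <= K by rewrite lerDl !mulr_ge0 ?enorm_ge0.
have [e e0 [edl eK]] : exists2 e : R, 0 < e & e < dl /\ e * K <= a' - a.
  exists (Num.min (dl / 2) ((a' - a) / K)).
    by rewrite lt_min !divr_gt0//; lra.
  split; first by rewrite gt_min; apply/orP; left; lra.
  by rewrite -ler_pdivlMr; [rewrite ge_min lexx orbT|lra].
have [v [phi [fv vw le]]] := approx e e0.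
have : V v.
  apply: wV; split=> // i j; rewrite ord1; apply: (le_lt_trans _ edl).
  rewrite /= distrC; apply: le_trans vw.
  by have := coord_le_enorm (v - w) j; rewrite !mxE.
move=> /fV; rewrite fv lte_fin => a'phi.
have E : dot (v - x) (v - x) =
    dot (w - x) (w - x) + 2 * dot (w - x) (v - w) + dot (v - w) (v - w).
  by rewrite !dotE (dotC v w) (dotC x v) (dotC x w); ring.
have := dot_le_enorm (x - w) (v - w).
have -> : enorm (x - w) = enorm (w - x).
  apply/eqP; rewrite -(@eqrXn2 _ 2)// ?enorm_ge0// !enorm_sqr.
  by rewrite !dotE (dotC x w); apply/eqP; ring.
rewrite -(opprB w x) dotNl => CS.
have CS' : enorm (w - x) * enorm (v - w) <= enorm (w - x) * e.
  by rewrite ler_wpM2l ?enorm_ge0.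
have : c * (- 2 * enorm (w - x) * e) <= c * (2 * dot (w - x) (v - w) + dot (v - w) (v - w)).
  by rewrite ler_wpM2l//; have := dot_ge0 (v - w); lra.
by move: le eK; rewrite E /K /a in aa' *; lra.
Qed.

End ProperFunction.

(** * Completeness and minimizers of strongly convex objectives *)

Lemma enorm_complete {R : realType} {n : nat} (u : nat -> 'rV[R]_n) :
  (forall e : R, 0 < e -> exists N, forall k, (N <= k)%N -> enorm (u N - u k) <= e) ->
  exists w, forall e : R, 0 < e ->
    exists N, forall k, (N <= k)%N -> enorm (u k - w) <= e.
Proof.
move=> u_cauchy.
have /cauchy_cvgP/cvg_ex[/= w uw] : cauchy (u @ \oo).
  apply: cauchy_exP => e e0; have [N hN] := u_cauchy (e / 2) (divr_gt0 e0 (ltr0Sn _ _)).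
  exists (u N); exists N => // k /= /hN h; split=> // i j; rewrite ord1.
  apply: (@le_lt_trans _ _ (e / 2)); last by lra.
  by apply: le_trans h; have := coord_le_enorm (u N - u k) j; rewrite !mxE.
exists w => e e0.
(* Coordinates within [e / (n + 1)] suffice, as [n (e / (n + 1))^2 <= e^2]; the successor covers
   [n = 0]. *)
have d0 : 0 < e / n.+1%:R by rewrite divr_gt0.
have /cvg_ballP/(_ _ d0)[N _ hN] := uw.
exists N => k /hN/= h; rewrite enorm_le_sqr; last exact: ltW.
apply: (@le_trans _ _ (n%:R * (e / n.+1%:R) ^+ 2)).
  apply: dot_le_coord => i; have := h.2 0 i.
  by rewrite !mxE distrC => /ltW.
have {2}-> : e = (e / n.+1%:R) * (n%:R + 1) by rewrite natr1 divfK.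
rewrite [leRHS]exprMn [leLHS]mulrC ler_wpM2l ?sqr_ge0//.
by have : 0 <= n%:R :> R by []; nra.
Qed.

Section StronglyConvexArgmin.
Context {R : realType} {n : nat}.
Variables (f : 'rV[R]_n -> \bar R) (c s : R).
Hypothesis f_gtNy : forall x, (-oo < f x)%E.
Hypothesis c_ge0 : 0 <= c.
Hypothesis s_gt0 : 0 < s.
Hypothesis f_conv : forall (a b : 'rV[R]_n) (al be t : R),
  f a = al%:E -> f b = be%:E -> 0 < t -> t < 1 ->
  (f ((1 - t) *: a + t *: b) <=
    ((1 - t) * al + t * be + (c - s) * (t * (1 - t) * dot (a - b) (a - b)))%:E)%E.
Implicit Types (a b p q x z : 'rV[R]_n).

Let q2 x z := c * dot (z - x) (z - x).

(** The quadratic [q2 x] supplies curvature [c], and [f_conv] uses up only [c - s] of it. *)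
Lemma prox_obj_strongly_convex x a b (al be t : R) :
  f a = al%:E -> f b = be%:E -> 0 < t -> t < 1 ->
  exists2 ga, f ((1 - t) *: a + t *: b) = ga%:E &
    ga + q2 x ((1 - t) *: a + t *: b) <=
    (1 - t) * (al + q2 x a) + t * (be + q2 x b)
      - s * (t * (1 - t) * dot (a - b) (a - b)).
Proof.
move=> fa fb t0 t1; have := f_conv a b al be t fa fb t0 t1.
case: (f _) (f_gtNy ((1 - t) *: a + t *: b)) => [ga||]// _.
rewrite lee_fin => h; exists ga => //; rewrite /q2.
have -> : (1 - t) *: a + t *: b - x = (1 - t) *: (a - x) + t *: (b - x).
  by apply/rowP => i; rewrite !mxE; ring.
rewrite dot_convex_comb.
have -> : a - x - (b - x) = a - b by rewrite opprB addrA subrK.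
lra.
Qed.

(** Compare [p] with a point at fraction [t] of the way to [q], divide by [t] and let [t] tend to
    0. *)
Lemma argmin_quadratic_growth x p q (phi ps : R) :
  f p = phi%:E -> f q = ps%:E ->
  (forall z ze, f z = ze%:E -> phi + q2 x p <= ze + q2 x z) ->
  phi + q2 x p + s * dot (p - q) (p - q) <= ps + q2 x q.
Proof.
move=> fp fq pmin; apply/ler_addgt0Pr => e e0.
pose D := s * dot (p - q) (p - q).
have D0 : 0 <= D by rewrite mulr_ge0 ?dot_ge0// ltW.
pose t := e / (D + e + e).
have De : 0 < D + e + e by lra.
have t0 : 0 < t by rewrite divr_gt0.
have t1 : t < 1 by rewrite ltr_pdivrMr// mul1r; lra.
have tD : t * D <= e by rewrite mulrAC ler_pdivrMr//; nra.
have [ga fga h] := prox_obj_strongly_convex x p q phi ps t fp fq t0 t1.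
have {}h := le_trans (pmin _ _ fga) h.
have : t * (phi + q2 x p + D - t * D) <= t * (ps + q2 x q) by rewrite /D; lra.
by rewrite ler_pM2l// -/D; lra.
Qed.

Lemma strongly_convex_argmin (f_lsc : lower_semicontinuous f) x (m : R) :
  (exists x0, (f x0 < +oo)%E) ->
  (forall z ze, f z = ze%:E -> m <= ze + q2 x z) ->
  exists p, exists2 phi, f p = phi%:E &
    forall z ze, f z = ze%:E -> phi + q2 x p <= ze + q2 x z.
Proof.
move=> [x0 fx0] mlb.
pose E := [set r | exists z ze, f z = ze%:E /\ r = ze + q2 x z].
have Einf : has_inf E.
  split; last by exists m => _ [z [ze [fz ->]]]; exact: mlb.
  case fE : (f x0) fx0 (f_gtNy x0) => [ze||]// _ _.
  by exists (ze + q2 x x0), x0, ze.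
have infE z ze : f z = ze%:E -> inf E <= ze + q2 x z.
  by move=> fz; apply: (ge_inf Einf.2); exists z, ze.
have /choice[u hu] : forall k : nat, exists z, exists2 ze, f z = ze%:E &
    ze + q2 x z < inf E + k.+1%:R^-1.
  move=> k; have k0 : 0 < k.+1%:R^-1 :> R by rewrite invr_gt0.
  have [r [z [ze [fz ->]]] lt] := inf_adherent k0 Einf.
  by exists z, ze.
have small (e : R) : 0 < e -> exists N, forall k, (N <= k)%N -> k.+1%:R^-1 <= e.
  move=> e0; have [N _ hN] := near_infty_natSinv_lt (PosNum e0).
  by exists N => k /hN/ltW.
(* The objective at the midpoint of [u N] and [u k] is at least [inf E], so strong convexity bounds
   their distance by their excesses. *)
have close N k : (N <= k)%N -> s * dot (u N - u k) (u N - u k) <= 4 * N.+1%:R^-1.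
  move=> Nk; have [z1 f1 h1] := hu N; have [z2 f2 h2] := hu k.
  have h0 : 0 < 2^-1 :> R by rewrite invr_gt0.
  have h3 : 2^-1 < 1 :> R by lra.
  have [ga fga h] := prox_obj_strongly_convex x _ _ _ _ _ f1 f2 h0 h3.
  have := infE _ _ fga.
  have : k.+1%:R^-1 <= N.+1%:R^-1 :> R by rewrite lef_pV2 ?posrE// ler_nat.
  move: h1 h2 h; move: (N.+1%:R^-1) (k.+1%:R^-1) (inf E) => eN ek i.
  by lra.
have [|p up] := enorm_complete u.
  move=> e e0; have [|N hN] := small (s * e ^+ 2 / 4).
    by rewrite divr_gt0// mulr_gt0// exprn_gt0.
  exists N => k Nk; rewrite enorm_le_sqr; last exact: ltW.
  rewrite -(ler_pM2l s_gt0); move: (close N k Nk) (hN N (leqnn N)).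
  by move: (N.+1%:R^-1) => eN; lra.
have fp : (f p <= (inf E - q2 x p)%:E)%E.
  apply: (lsc_quadratic_le _ f_lsc) => // e e0.
  have [N1 h1] := up e e0; have [N2 h2] := small e e0.
  have [ze fz hz] := hu (maxn N1 N2).
  exists (u (maxn N1 N2)), ze; split; rewrite ?h1 ?leq_maxl//.
  apply: (le_trans (ltW hz)); rewrite lerD2l.
  exact: h2 (leq_maxr _ _).
move: fp; case fE : (f p) (f_gtNy p) => [phi||]// _; rewrite lee_fin => hp.
by exists p, phi => // z ze /infE; lra.
Qed.

End StronglyConvexArgmin.

(* Below the threshold, the quadratic minorant of f that a larger parameter
   provides is dominated by the quadratic term of the proximal objective. *)
Lemma prox_obj_bounded_below {R : realType} {n : nat} (f : 'rV[R]_n -> \bar R)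
    (mu : R) (x : 'rV[R]_n) :
  0 < mu -> (mu%:E < prox_threshold f)%E ->
  exists m, forall z ze, f z = ze%:E ->
    m <= ze + (2 * mu)^-1 * dot (z - x) (z - x).
Proof.
move=> mu0 /ereal_sup_gt[_ [la [la0 [x0 hx0]] <-]]; rewrite lte_fin => mula.
have [m hm] : exists m : R, (m%:E <= moreau_env la f x0)%E.
  move: hx0; case: (moreau_env la f x0) => [r||]// _; first by exists r.
  by exists 0; rewrite leey.
pose A := (2 * mu)^-1; pose B := (2 * la)^-1.
have B0 : 0 < B by rewrite invr_gt0; lra.
have AB : 0 < A - B by rewrite subr_gt0 ltf_pV2 ?posrE; lra.
(* Completing the square in [a = z - x], with [d = x - x0]: this is the minimum of
   [A |a|^2 - B |a + d|^2] plus [m]. *)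
exists (m - (B ^+ 2 / (A - B) + B) * dot (x - x0) (x - x0)) => z ze fz.
have : (m%:E <= prox_obj la f x0 z)%E.
  by apply: (le_trans hm); apply: ereal_inf_lbound; exists z.
rewrite /prox_obj fz lee_fin enorm_sqr -/A -/B.
have -> : z - x0 = (z - x) + (x - x0) by rewrite addrA subrK.
move: (z - x) (x - x0) => a d.
have := dot_ge0 ((A - B) *: a - B *: d); rewrite !dotE (dotC d a) => h.
have : 0 <= (A - B) * ((A - B) * dot a a - 2 * B * dot a d
    + B ^+ 2 / (A - B) * dot d d).
  by apply: le_trans h _; rewrite le_eqVlt; apply/orP; left; apply/eqP; field; lra.
by rewrite pmulr_rge0//; lra.
Qed.

Theorem proposition4p3 (R : realType) (n : nat) (f : 'rV[R]_n -> \bar R)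
    (mu kappa : R)
    (f_proper : proper_function f)
    (f_lsc : lower_semicontinuous f)
    (f_prox_bounded : prox_bounded f)
    (threshold_gt0 : (0 < prox_threshold f)%E)
    (mu_gt0 : 0 < mu)
    (mu_lt_threshold : (mu%:E < prox_threshold f)%E)
    (kappa_gt0 : 0 < kappa) :
  set_valued_lipschitz kappa (prox mu f) <->
  econvex (fun x : 'rV[R]_n =>
    (f x + ((kappa - 1) / (2 * mu * kappa) * enorm x ^+ 2)%:E)%E).
Proof.
have [f_gtNy f_fin] := f_proper.
rewrite (econvex_quadraticP f f_gtNy).
have mu2_gt0 : 0 < (2 * mu)^-1 by rewrite invr_gt0 mulr_gt0.
have obj_bounded x := prox_obj_bounded_below f mu x mu_gt0 mu_lt_threshold.
clear threshold_gt0 mu_lt_threshold.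
split=> [[P [proxP P_lip]] a b al be t fa fb t0 t1|f_conv].
  pose S : set 'rV[R]_n := [set z | f z \is a fin_num].
  (* Up to the constant [|x|^2 / 2], [mu] times the proximal objective at [x] is [G z - dot x z], so
     [P x] maximizes [dot x z - G z] over the domain [S], where [fine] is faithful. *)
  pose G z := mu * fine (f z) + dot z z / 2.
  have P_prox x := (prox_finP f f_gtNy f_fin mu x (P x)).1
    (eq_ind_r (fun A : set _ => A (P x)) erefl (proxP x)).
  have P_mem x : S (P x) by have [phi e _] := P_prox x; rewrite /S /= e.
  have P_max x z : S z -> dot x z - G z <= dot x (P x) - G (P x).
    have [phi e h] := P_prox x; rewrite /S /G /= => /fineK fz.
    have := h z _ (esym fz); rewrite e /= -(ler_pM2l mu_gt0).
    have muE A : mu * ((2 * mu)^-1 * A) = A / 2 by field; exact: lt0r_neq0.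
    by rewrite ![mu * (_ + _)]mulrDr !muE !dotE (dotC z x) (dotC (P x) x); lra.
  set w := _ + _; pose M := (1 - t) * G a + t * G b
    - (2 * kappa)^-1 * (t * (1 - t) * dot (a - b) (a - b)).
  have Sa : S a by rewrite /S /= fa.
  have Sb : S b by rewrite /S /= fb.
  have hM y : dot y w - (dot y (P y) - G (P y)) <= M.
    exact: (biconjugate_strongly_convex S G P kappa).
  have : (f w <= (M / mu - (2 * mu)^-1 * dot (w - 0) (w - 0))%:E)%E.
    apply: (lsc_quadratic_le f f_lsc); first exact: ltW.
    (* The bound on [G] is divided by [mu] below, hence [e * mu]. *)
    move=> e e0; pose e' := Num.min e (e * mu).
    have e'0 : 0 < e' by rewrite lt_min e0 mulr_gt0.
    have [y [yw GM]] := approx_by_range S G P kappa kappa_gt0 P_mem P_max P_lip w M e' hM e'0.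
    have [phi fy _] := P_prox y; exists (P y), phi; split => //.
      by apply: le_trans yw _; rewrite ge_min lexx.
    move: GM; rewrite /G fy /= subr0 => GM.
    have e'e : e' <= e * mu by rewrite ge_min lexx orbT.
    have -> : phi + (2 * mu)^-1 * dot (P y) (P y) = (mu * phi + dot (P y) (P y) / 2) / mu.
      by field; exact: lt0r_neq0.
    by rewrite ler_pdivrMr// mulrDl divfK; lra.
  move/le_trans; apply; rewrite lee_fin subr0 le_eqVlt; apply/orP; left; apply/eqP.
  rewrite /w dot_convex_comb /M /G fa fb /=; field.
  by rewrite !lt0r_neq0.
have s_gt0 : 0 < (2 * mu * kappa)^-1 by rewrite invr_gt0 !mulr_gt0.
(* The proximal term carries [1 / (2 mu)], so [1 / (2 mu kappa)] remains as the modulus [s] of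
   strong convexity. *)
have cE : (kappa - 1) / (2 * mu * kappa) = (2 * mu)^-1 - (2 * mu * kappa)^-1.
  by field; rewrite !lt0r_neq0.
rewrite cE in f_conv.
have growth := argmin_quadratic_growth f _ _ f_gtNy s_gt0 f_conv.
have /choice[P hP] : forall x, exists p, prox mu f x p.
  move=> x; have [m hm] := obj_bounded x.
  have [p hp] := strongly_convex_argmin f _ _ f_gtNy (ltW mu2_gt0) s_gt0 f_conv f_lsc x m f_fin hm.
  by exists p; apply/prox_finP.
exists P; split=> [x|x y].
  apply/seteqP; split=> [p /= | _ ->]; last exact: hP.
  move=> /(prox_finP f f_gtNy f_fin)[ps fp hp].
  have /(prox_finP f f_gtNy f_fin)[phi fP hPx] := hP x.
  have := growth _ _ _ _ _ fp fP hp; have := hPx _ _ fp => h1 h2.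
  apply/eqP; rewrite -subr_eq0; apply/eqP/dot_eq0.
  by rewrite -(pmulr_rle0 _ s_gt0); lra.
have /(prox_finP f f_gtNy f_fin)[phi fP hPx] := hP x.
have /(prox_finP f f_gtNy f_fin)[ps fQ hPy] := hP y.
have h1 := growth _ _ _ _ _ fP fQ hPx.
have h2 := growth _ _ _ _ _ fQ fP hPy.
have key : dot (P x - P y) (P x - P y) <= kappa * dot (x - y) (P x - P y).
  move: h1 h2 {hPx hPy growth}; move: (P x) (P y) => p q h1 h2.
  have {h1 h2} := lerD h1 h2.
  have -> : dot (q - p) (q - p) = dot (p - q) (p - q).
    by rewrite -opprB dotNl dotNr opprK.
  set D := dot (p - q) (p - q); rewrite invfM => h.
  have : (2 * mu)^-1 * (kappa^-1 * D) <= (2 * mu)^-1 * dot (x - y) (p - q).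
    move: h; rewrite !dotE (dotC p x) (dotC q x) (dotC p y) (dotC q y); lra.
  by rewrite ler_pM2l// ler_pdivrMl.
have [->|d0] := eqVneq (enorm (P x - P y)) 0.
  by rewrite mulr_ge0 ?enorm_ge0 ?(ltW kappa_gt0).
have d_gt0 : 0 < enorm (P x - P y) by rewrite lt_def d0 enorm_ge0.
rewrite -(ler_pM2r d_gt0) -expr2 enorm_sqr; apply: (le_trans key).
by rewrite -mulrA ler_pM2l// dot_le_enorm.
Qed.
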